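(* Suppose that $I\neq\emptyset$ and $r_i>0$ for every $i\in I$. An element $\bar{x}\in\mathbb{R}^n$ is the optimal solution of the problem of minimizing $\mathcal{G}(x)$ over $x\in\mathbb{R}^n$ if and only if one of the following conditions holds: (1) With $r=\mathcal{G}(\bar{x})$, the ball $\mathbb{B}(\bar{x};r)$ coincides with $k$ of the balls $\Omega_i$, $i\in I$, for some $k\ge 1$; $\mathbb{B}(\bar{x};r)$ contains the other balls in $\{\Omega_i : i\in I\}$; and $\mathbb{B}(\bar{x};r)$ intersects $\Theta_j$ for every $j\in J$. (2) The sets $\mathcal{P}(\bar{x};\Omega_i)$, $i\in K(\bar{x})$, and $\Pi(\bar{x};\Theta_j)$, $j\in L(\bar{x})$, are singletons and, denoting by $p_i$ the unique element of $\mathcal{P}(\bar{x};\Omega_i)$ and by $q_j$ the unique element of $\Pi(\bar{x};\Theta_j)$, one has $$\bar{x}\in \mathrm{co}\,\{p_i,\, q_j : i\in K(\bar{x}),\ j\in L(\bar{x})\}.$$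
   Context: $\mathbb{R}^n$ carries the Euclidean norm $\|\cdot\|$, $\mathbb{B}(c;r)$ is the closed ball of center $c$ and radius $r\ge0$, and $\mathrm{co}$ denotes the convex hull. $I$ and $J$ are finite index sets with $|I|+|J|>1$. $\Omega_i=\mathbb{B}(a_i;r_i)$ for $i\in I$, and $\Theta_j=\mathbb{B}(b_j;s_j)$, $s_j\ge 0$, for $j\in J$. For a closed bounded convex set $Q$, $M(x;Q)=\sup\{\|x-q\| : q\in Q\}$, $D(x;Q)=\inf\{\|x-q\| : q\in Q\}$, the farthest projection is $\mathcal{P}(x;Q)=\{q\in Q : \|x-q\|=M(x;Q)\}$ and the shortest projection is $\Pi(x;Q)=\{q\in Q : \|x-q\|=D(x;Q)\}$. $\mathcal{G}(x)=\max\big(\{M(x;\Omega_i) : i\in I\}\cup\{D(x;\Theta_j) : j\in J\}\big)$. Active index sets: $K(x)=\{i\in I : M(x;\Omega_i)=\mathcal{G}(x)\}$ and $L(x)=\{j\in J : D(x;\Theta_j)=\mathcal{G}(x)\}$. When $I\ne\emptyset$ the minimizer of $\mathcal{G}$ exists and is unique. *)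

(* Defs.v *)
From HB Require Import structures.
From mathcomp Require Import all_boot all_order all_algebra.
From mathcomp Require Import all_classical all_reals all_analysis.

Set Implicit Arguments.
Unset Strict Implicit.
Unset Printing Implicit Defensive.

Import Order.TTheory GRing.Theory Num.Theory.

Local Open Scope classical_set_scope.
Local Open Scope ring_scope.

(* The canonical norm `|x| on 'rV[R]_n is the sup norm, hence a separate
   definition of the Euclidean norm. *)
Definition enorm (R : realType) (n : nat) (x : 'rV[R]_n) : R :=
  Num.sqrt (\sum_(i < n) x ord0 i ^+ 2).

Definition eball (R : realType) (n : nat) (c : 'rV[R]_n) (r : R) :
    set 'rV[R]_n :=
  closed_ball_ (@enorm R n) c r.

Definition convex_hull (R : realType) (n : nat) (A : set 'rV[R]_n) :
    set 'rV[R]_n :=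
  smallest (fun B : set 'rV[R]_n => convex_set (B : set (convex_lmodType _))) A.

Definition maxdist (R : realType) (n : nat) (x : 'rV[R]_n)
    (Q : set 'rV[R]_n) : R :=
  sup [set enorm (x - q) | q in Q].

Definition mindist (R : realType) (n : nat) (x : 'rV[R]_n)
    (Q : set 'rV[R]_n) : R :=
  inf [set enorm (x - q) | q in Q].

Definition farthest_proj (R : realType) (n : nat) (x : 'rV[R]_n)
    (Q : set 'rV[R]_n) : set 'rV[R]_n :=
  [set q | Q q /\ enorm (x - q) = maxdist x Q].

Definition shortest_proj (R : realType) (n : nat) (x : 'rV[R]_n)
    (Q : set 'rV[R]_n) : set 'rV[R]_n :=
  [set q | Q q /\ enorm (x - q) = mindist x Q].

(* The base value 0 of the iterated maxima does not affect the maximum of a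
   nonempty family, since all the distances are nonnegative. *)
Definition objective (R : realType) (n : nat) (I J : finType)
    (Omega : I -> set 'rV[R]_n) (Theta : J -> set 'rV[R]_n)
    (x : 'rV[R]_n) : R :=
  Num.max (\big[Num.max/0]_(i : I) maxdist x (Omega i))
          (\big[Num.max/0]_(j : J) mindist x (Theta j)).

Definition active_far (R : realType) (n : nat) (I J : finType)
    (Omega : I -> set 'rV[R]_n) (Theta : J -> set 'rV[R]_n)
    (x : 'rV[R]_n) : set I :=
  [set i | maxdist x (Omega i) = objective Omega Theta x].

Definition active_near (R : realType) (n : nat) (I J : finType)
    (Omega : I -> set 'rV[R]_n) (Theta : J -> set 'rV[R]_n)
    (x : 'rV[R]_n) : set J :=
  [set j | mindist x (Theta j) = objective Omega Theta x].

(* Main.v *)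
Require Import Defs.
From HB Require Import structures.
From mathcomp Require Import all_boot all_order all_algebra.
From mathcomp Require Import all_classical all_reals all_analysis.
From mathcomp Require Import ring lra.

Set Implicit Arguments.
Unset Strict Implicit.
Unset Printing Implicit Defensive.

Import Order.TTheory GRing.Theory Num.Theory.

Local Open Scope classical_set_scope.
Local Open Scope ring_scope.

(** The objective is a maximum of distances to balls, and in positive dimension
    such distances are explicit: [M(x; B(a; r)) = |x - a| + r] and
    [D(x; B(b; s)) = max(0, |x - b| - s)] ([maxdist_ball], [mindist_ball]).
    As every [r i] is positive, [G] is positive everywhere.

    Let [g = G xbar]. The active sets are seen from [xbar] in definite
    directions: unless [xbar = a i], the farthest point of an active [Omega i]
    is the point of the ray from [xbar] through [a i] at distance [g], and the
    nearest point of an active [Theta j] is the point of the ray from [xbar]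
    through [b j] at distance [g]. Both are instances of one fact, the equality
    case of the reverse triangle inequality ([reverse_triangle_rigid],
    [tangent_ball]).

    Condition (1) holds as soon as [xbar] is the center of an active
    [Omega i], since then [r i = g]; conversely it forces [G y >= g + |y - xbar|]
    because one of the [Omega i] is the ball of radius [g] around [xbar].

    If no active [Omega i] is centered at [xbar], optimality means that no
    direction [v] decreases all the active distances at first order, that is,
    no [v] has a positive inner product with all the vectors [p i - xbar] and
    [q j - xbar]. By Gordan's theorem of the alternative
    ([gordan_alternative]) this says that [xbar] is in the convex hull of the
    [p i] and [q j]. Sufficiency needs no differentiation: a better point [y]
    is strictly closer than [xbar] to every [p i] and to every active [b j],
    hence all the [p i] and [q j] lie in the open half-space
    [{z | 0 < <y - xbar, z - xbar>}], which is convex and omits [xbar].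

    In dimension 0 the distance formulas fail (a ball of radius [r > 0] is a
    single point), but there every point is optimal and all balls coincide. *)

(** * Euclidean inner product and norm *)

Definition dot (R : realType) (n : nat) (u v : 'rV[R]_n) : R :=
  \sum_(i < n) u ord0 i * v ord0 i.

Section EuclideanNorm.
Variables (R : realType) (n : nat).
Implicit Types (u v w x y z : 'rV[R]_n) (k : R).

Lemma dotC u v : dot u v = dot v u.
Proof. by apply: eq_bigr => i _; rewrite mulrC. Qed.

Lemma dotDr u v w : dot u (v + w) = dot u v + dot u w.
Proof. by rewrite -big_split; apply: eq_bigr => i _; rewrite mxE mulrDr. Qed.

Lemma dotZr k u v : dot u (k *: v) = k * dot u v.
Proof. by rewrite mulr_sumr; apply: eq_bigr => i _; rewrite mxE mulrCA. Qed.

Lemma dotNr u v : dot u (- v) = - dot u v.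
Proof. by rewrite -scaleN1r dotZr mulN1r. Qed.

Lemma dot0r u : dot u 0 = 0.
Proof. by rewrite -[X in dot _ X](scale0r 0) dotZr mul0r. Qed.

Lemma dotDl u v w : dot (u + v) w = dot u w + dot v w.
Proof. by rewrite dotC dotDr !(dotC w). Qed.

Lemma dotZl k u v : dot (k *: u) v = k * dot u v.
Proof. by rewrite dotC dotZr dotC. Qed.

Lemma dotNl u v : dot (- u) v = - dot u v.
Proof. by rewrite dotC dotNr dotC. Qed.

Definition dotE := (dotDl, dotDr, dotZl, dotZr, dotNl, dotNr).

Lemma dot_ge0 u : 0 <= dot u u.
Proof. by apply: sumr_ge0 => i _; rewrite -expr2 sqr_ge0. Qed.

Lemma dot_le0 u : dot u u <= 0 -> u = 0.
Proof.
move=> u0; apply/rowP => i; rewrite mxE.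
have /eqP : dot u u = 0 by apply/le_anti; rewrite u0 dot_ge0.
rewrite psumr_eq0 => [|j _]; last by rewrite -expr2 sqr_ge0.
by move/allP/(_ i (mem_index_enum i)); rewrite -expr2 sqrf_eq0 => /eqP.
Qed.

Lemma dot_gt0 u : u != 0 -> 0 < dot u u.
Proof. by move=> u0; rewrite ltNge; apply: contra u0 => /dot_le0 ->. Qed.

Lemma enorm_ge0 u : 0 <= enorm u.
Proof. exact: sqrtr_ge0. Qed.

Lemma enorm_sqr u : enorm u ^+ 2 = dot u u.
Proof.
rewrite sqr_sqrtr; first by apply: eq_bigr => i _; rewrite expr2.
by apply: sumr_ge0 => i _; exact: sqr_ge0.
Qed.

Lemma enorm_lt u v : (enorm u < enorm v) = (dot u u < dot v v).
Proof. by rewrite -!enorm_sqr ltr_sqr ?nnegrE ?enorm_ge0. Qed.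

Lemma enorm_gt0 u : u != 0 -> 0 < enorm u.
Proof.
by move=> u0; rewrite lt_neqAle enorm_ge0 eq_sym -sqrf_eq0
  enorm_sqr gt_eqF ?dot_gt0.
Qed.

Lemma enormZ k u : enorm (k *: u) = `|k| * enorm u.
Proof.
apply/eqP; rewrite -(@eqrXn2 _ 2)// ?mulr_ge0 ?enorm_ge0//.
by rewrite exprMn real_normK ?num_real// !enorm_sqr !dotE mulrA.
Qed.

Lemma enorm0 : enorm (0 : 'rV[R]_n) = 0.
Proof. by rewrite -(scale0r 0) enormZ normr0 mul0r. Qed.

Lemma enormB_sym x y : enorm (x - y) = enorm (y - x).
Proof. by rewrite -opprB -scaleN1r enormZ normrN1 mul1r. Qed.

(** The left side is nonnegative, which yields the Cauchy-Schwarz inequality,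
    and for nonzero vectors it vanishes only when they point the same way, which
    yields its equality case. *)
Lemma dot_scaled_difference u v :
  dot (enorm u *: v - enorm v *: u) (enorm u *: v - enorm v *: u) =
  2 * (enorm u * enorm v) * (enorm u * enorm v - dot u v).
Proof. by rewrite !dotE -!enorm_sqr (dotC v u); ring. Qed.

Lemma cauchy_schwarz u v : dot u v <= enorm u * enorm v.
Proof.
have [->|u0] := eqVneq u 0.
  by rewrite dotC dot0r mulr_ge0 ?enorm_ge0.
have [->|v0] := eqVneq v 0; first by rewrite dot0r mulr_ge0 ?enorm_ge0.
have := dot_ge0 (enorm u *: v - enorm v *: u).
rewrite dot_scaled_difference pmulr_rge0 ?subr_ge0//.
by rewrite mulr_gt0// mulr_gt0// enorm_gt0.
Qed.

Lemma enormD u v : enorm (u + v) <= enorm u + enorm v.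
Proof.
rewrite -ler_sqr ?nnegrE ?addr_ge0 ?enorm_ge0// enorm_sqr sqrrD !enorm_sqr.
by rewrite !dotE (dotC v u); have := cauchy_schwarz u v; lra.
Qed.

Lemma enorm_dist_triangle y x z :
  enorm (x - z) <= enorm (x - y) + enorm (y - z).
Proof.
by apply: le_trans (enormD _ _); rewrite addrA subrK.
Qed.

(** Squaring the hypothesis gives [|u| |w| <= <u, w>], so that the vector
    [|u| w - |w| u] has a nonpositive square by [dot_scaled_difference]. *)
Lemma reverse_triangle_rigid u w : u != 0 ->
  enorm (u - w) <= `|enorm w - enorm u| -> w = (enorm w / enorm u) *: u.
Proof.
move=> u0; have du := enorm_gt0 u0.
rewrite -ler_sqr ?nnegrE ?enorm_ge0// real_normK ?num_real// enorm_sqr.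
rewrite !dotE (dotC w u) sqrrB -!enorm_sqr => uw.
have /dot_le0 : dot (enorm u *: w - enorm w *: u)
                    (enorm u *: w - enorm w *: u) <= 0.
  rewrite dot_scaled_difference mulr_ge0_le0//.
    by rewrite mulr_ge0// mulr_ge0// enorm_ge0.
  by lra.
move/eqP; rewrite subr_eq0 => /eqP e.
by rewrite mulrC -scalerA -e scalerA mulVf ?scale1r ?gt_eqF.
Qed.

(** The points closer to [y] than to [x] lie beyond the bisecting hyperplane,
    hence beyond the parallel one through [x]. *)
Lemma dot_gt0_of_closer x y z :
  enorm (y - z) < enorm (x - z) -> 0 < dot (y - x) (z - x).
Proof.
rewrite enorm_lt => h.
have := dot_ge0 (y - x); move: h; rewrite !dotE.
rewrite (dotC z x) (dotC z y) (dotC y x); lra.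
Qed.

(** The sphere of radius [rho] around [x] is internally or externally tangent to
    [B(c; s)], at a point of the ray from [x] through [c]. With
    [rho = |x - c| + s] this determines the farthest point of the ball from [x],
    with [rho = |x - c| - s] the nearest one. *)
Lemma tangent_ball x c s rho : c != x -> 0 <= rho ->
    `|rho - enorm (x - c)| = s ->
  [set q | eball c s q /\ enorm (x - q) = rho] =
  [set x + (rho / enorm (x - c)) *: (c - x)].
Proof.
rewrite -subr_eq0 => cx rho0 rs; have d0 := enorm_gt0 cx.
rewrite enormB_sym in rs *.
apply/seteqP; split => [q /= [cq xq]|_ /= ->].
  have e : enorm (q - x) = rho by rewrite enormB_sym.
  rewrite -[LHS](subrK x) addrC; congr (_ + _).
  rewrite -e; apply: reverse_triangle_rigid => //.
  by rewrite e rs opprB addrA subrK.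
split.
  rewrite /eball /closed_ball_ /= opprD addrA -[X in enorm (X - _)]scale1r.
  rewrite -scalerBl enormZ -rs -{2}(gtr0_norm d0) -normrM mulrBl mul1r.
  by rewrite divfK ?gt_eqF// distrC.
rewrite opprD addrA subrr sub0r -scaleNr enormZ normrN.
by rewrite ger0_norm ?divfK ?gt_eqF// divr_ge0// enorm_ge0.
Qed.

Lemma near_ray_lt x v z k : enorm (x - z) < k ->
  \forall t \near 0^'+, enorm (x + t *: v - z) < k.
Proof.
move=> xk; have e0 : 0 < (k - enorm (x - z)) / (enorm v + 1).
  by rewrite divr_gt0 ?subr_gt0// ltr_wpDl ?enorm_ge0.
near=> t.
have t0 : 0 < t by near: t; exact: nbhs_right_gt.
have : t < (k - enorm (x - z)) / (enorm v + 1).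
  by near: t; exact: nbhs_right_lt.
rewrite ltr_pdivlMr; last by rewrite ltr_wpDl ?enorm_ge0.
move=> tk; rewrite addrAC; apply: le_lt_trans (enormD _ _) _.
by rewrite enormZ gtr0_norm// -ltrBrDl (le_lt_trans _ tk)// ler_pM2l// lerDl.
Unshelve. all: by end_near. Qed.

(** The squared distance changes by [t (t |v|^2 - 2 <v, z - x>)], which is
    negative for small [t > 0]. *)
Lemma near_ray_descent x v z : 0 < dot v (z - x) ->
  \forall t \near 0^'+, enorm (x + t *: v - z) < enorm (x - z).
Proof.
move=> vz; have e0 : 0 < dot v (z - x) / (dot v v + 1).
  by rewrite divr_gt0// ltr_wpDl ?dot_ge0.
near=> t.
have t0 : 0 < t by near: t; exact: nbhs_right_gt.
have : t < dot v (z - x) / (dot v v + 1) by near: t; exact: nbhs_right_lt.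
rewrite ltr_pdivlMr; last by rewrite ltr_wpDl ?dot_ge0.
move=> tk; rewrite addrAC enorm_lt -(opprB z x).
rewrite (_ : dot (- (z - x) + _) _ = dot (- (z - x)) (- (z - x)) +
  t * (t * dot v v - 2 * dot v (z - x))); last first.
  by rewrite (dotDl (- _)) !(dotDr _ (- (z - x))) !dotNl !dotNr !dotZl !dotZr
    !(dotC (z - x) v); ring.
rewrite gtrDl pmulr_rlt0//; lra.
Unshelve. all: by end_near. Qed.

End EuclideanNorm.

(** * Convex hulls of finite sets *)

Section ConvexHull.
Variables (R : realType) (n : nat).
Implicit Types (u v w x y z : 'rV[R]_n) (A B : set 'rV[R]_n).

Let convex B := convex_set (B : set (convex_lmodType 'rV[R]_n)).

Lemma convex_setP B : convex B <->
  (forall x y t, 0 <= t -> t <= 1 -> B x -> B y -> B (t *: x + (1 - t) *: y)).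
Proof.
split=> [cB x y t t0 t1 Bx By|cB x y t /[!inE] Bx By].
  by have := cB x y (Itv01 t0 t1); rewrite !inE; exact.
exact: cB.
Qed.

Lemma convex_hull_convex A : convex (convex_hull A).
Proof.
apply/convex_setP => x y t t0 t1 Ax Ay B [cB AB].
have /convex_setP := cB; apply=> //; [exact: Ax|exact: Ay].
Qed.

Lemma open_halfspace_convex v x : convex [set z | 0 < dot v (z - x)].
Proof.
apply/convex_setP => y z t t0 t1 /= vy vz.
rewrite (_ : _ - x = t *: (y - x) + (1 - t) *: (z - x)); last first.
  by apply/rowP => i; rewrite !mxE; ring.
rewrite dotDr !dotZr; have [->|tN0] := eqVneq t 0.
  by rewrite mul0r add0r subr0 mul1r.
rewrite ltr_pwDl// ?mulr_gt0// ?lt_neqAle ?t0 1?eq_sym ?tN0//.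
by rewrite mulr_ge0 ?subr_ge0// ltW.
Qed.

Lemma translate_convex x B : convex B ->
  convex [set z | B (x + z)].
Proof.
move=> /convex_setP cB; apply/convex_setP => y z t t0 t1 /= By Bz.
rewrite (_ : x + _ = t *: (x + y) + (1 - t) *: (x + z)).
  exact: cB.
by apply/rowP => i; rewrite !mxE; ring.
Qed.

(** This set is the cylinder over [B] in the direction [w]. It transfers hull
    membership from projected vectors back to the vectors themselves. *)
Lemma cylinder_convex w B : convex B ->
  convex [set z | exists t, B (z + t *: w)].
Proof.
move=> /convex_setP cB; apply/convex_setP => y z t t0 t1 /= [ty By] [tz Bz].
exists (t * ty + (1 - t) * tz).
rewrite [X in B X](_ : _ = t *: (y + ty *: w) + (1 - t) *: (z + tz *: w)).
  exact: cB.
by apply/rowP => i; rewrite !mxE; ring.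
Qed.

(** Induction on the number of vectors, eliminating the first one, [u], by
    projecting the others onto its orthogonal complement. If a vector is
    positive on all the projections, its own projection tilted slightly towards
    [u] is positive on all the vectors. Otherwise some multiple [t u] lies in
    the hull of the others: if [t <= 0] then [0] lies between [u] and [t u], and
    if [0 < t] every vector that is positive on the others is positive on [u],
    so that the induction hypothesis for the others suffices. *)
Lemma gordan_alternative (s : seq 'rV[R]_n) :
  convex_hull [set` s] 0 \/ exists v, forall w, w \in s -> 0 < dot v w.
Proof.
elim: {s}(size s) {-2}s (erefl (size s)) => [|m IH] [|u s]//= => [_|[sm]].
  by right; exists 0 => w; rewrite in_nil.
have us : [set` s] `<=` [set` u :: s] by move=> w /= ws; rewrite in_cons ws orbT.
have hus : convex_hull [set` s] `<=` convex_hull [set` u :: s].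
  apply: smallest_sub; first exact: convex_hull_convex.
  by move=> w /us; exact: sub_gen_smallest.
have hu : convex_hull [set` u :: s] u.
  by apply: sub_gen_smallest; rewrite /= mem_head.
have [u0|uN0] := eqVneq u 0; first by left; rewrite -u0.
have uu := dot_gt0 uN0.
pose proj w := w - (dot u w / dot u u) *: u.
have uproj w : dot u (proj w) = 0.
  by rewrite dotDr dotNr dotZr divfK ?subrr// gt_eqF.
have [|hp|[v hv]] := IH (map proj s); first by rewrite size_map.
  have : [set z | exists t, convex_hull [set` s] (z + t *: u)] 0.
    apply: hp; split; first by apply: cylinder_convex; exact: convex_hull_convex.
    move=> _ /= /mapP[w ws ->]; exists (dot u w / dot u u).
    by rewrite subrK; exact: sub_gen_smallest.
  move=> [t]; rewrite add0r => st; have [t0|t0] := leP t 0.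
    left; have /convex_setP := @convex_hull_convex [set` u :: s].
    have d0 : 0 < 1 - t by lra.
    (* the weight of [u] for which the combination of [u] and [t u] vanishes *)
    move=> /(_ u (t *: u) (- t / (1 - t))); rewrite scalerA -scalerDl.
    rewrite (_ : - t / (1 - t) + (1 - - t / (1 - t)) * t = 0).
      rewrite scale0r; apply=> //; last exact: hus.
        by rewrite divr_ge0 ?oppr_ge0// ltW.
      by rewrite ler_pdivrMr// mul1r; lra.
    by field; rewrite gt_eqF.
  have [/hus|[v hv]] := IH s sm; first by left.
  right; exists v => w; rewrite inE => /predU1P[->|]; last exact: hv.
  have : [set z | 0 < dot v (z - 0)] (t *: u).
    apply: st; split; first exact: open_halfspace_convex.
    by move=> z /= zs; rewrite subr0 hv.
  by rewrite /= subr0 dotZr pmulr_rgt0.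
right.
pose v' := proj v.
have vs w : w \in s -> 0 < dot v' w.
  move=> ws; have /hv : proj w \in map proj s by exact: map_f.
  rewrite /v' /proj dotDr dotNr dotZr dotDl dotNl dotZl (dotC v u).
  by rewrite !(mulrAC _ (dot u u)^-1) (mulrC (dot u w)).
(* a tilt small enough for all of the finitely many vectors *)
have [e [e0 he]] : exists e : R, 0 < e /\
    forall w, w \in s -> 0 < dot v' w + e * dot u w.
  have : \forall e \near 0^'+, forall i : 'I_(size s),
      0 < dot v' (tnth (in_tuple s) i) + e * dot u (tnth (in_tuple s) i).
    apply: filter_forall => i.
    have := vs _ (mem_tnth i (in_tuple s)); set w := tnth _ _ => vw.
    near=> e.
    have e0 : 0 < e by near: e; exact: nbhs_right_gt.
    have : e < dot v' w / (`|dot u w| + 1).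
      by near: e; apply: nbhs_right_lt; rewrite divr_gt0// ltr_wpDl.
    rewrite ltr_pdivlMr; last by rewrite ltr_wpDl.
    move=> h.
    have : - `|dot u w| <= dot u w by rewrite lerNl -normrN ler_norm.
    rewrite -(ler_pM2l e0); lra.
  move=> he; near (0 : R)^'+ => e; exists e; split.
    by near: e; exact: nbhs_right_gt.
  move=> w /seq_tnthP[i ->].
  by move: i; near: e.
exists (v' + e *: u) => w; rewrite dotDl dotZl inE => /predU1P[->|];
  last exact: he.
by rewrite (dotC v') uproj add0r mulr_gt0.
Unshelve. all: by end_near. Qed.

Lemma convex_hull_separation A x : finite_set A -> ~ convex_hull A x ->
  exists v, forall z, A z -> 0 < dot v (z - x).
Proof.
move=> /finite_seqP[s ->] sx.
have [h0|[v hv]] := gordan_alternative [seq z - x | z <- s]; last first.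
  by exists v => z /= zs; apply: hv; exact: map_f.
exfalso; apply: sx; have : [set z | convex_hull [set` s] (x + z)] 0.
  apply: h0; split.
    by apply: translate_convex; exact: convex_hull_convex.
  move=> _ /= /mapP[z zs ->]; rewrite addrC subrK.
  exact: sub_gen_smallest.
by rewrite /= addr0.
Qed.

End ConvexHull.

(** * Distances and projections to balls *)

Section BallDistances.
Variables (R : realType) (n : nat).
Implicit Types (c x q : 'rV[R]_n.+1).

(** The dimension is positive so that the zero vector has a direction, too: the
    distance formulas below then also cover the center of the ball. *)
Lemma unit_direction x : exists2 u, enorm u = 1 & x = enorm x *: u.
Proof.
have nu (w : 'rV[R]_n.+1) : w != 0 -> enorm ((enorm w)^-1 *: w) = 1.
  move=> w0; rewrite enormZ ger0_norm ?invr_ge0 ?enorm_ge0//.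
  by rewrite mulVf// gt_eqF// enorm_gt0.
have [x0|x0] := eqVneq x 0; last first.
  exists ((enorm x)^-1 *: x); first exact: nu.
  by rewrite scalerA mulfV ?scale1r// gt_eqF// enorm_gt0.
exists ((enorm (const_mx 1 : 'rV[R]_n.+1))^-1 *: const_mx 1).
  by apply: nu; apply/eqP => /rowP/(_ ord0)/eqP; rewrite !mxE oner_eq0.
suff -> : enorm x = 0 by rewrite scale0r.
by rewrite x0 enorm0.
Qed.

Lemma maxdist_ball x c r : 0 <= r -> maxdist x (eball c r) = enorm (x - c) + r.
Proof.
move=> r0; have [u u1 xu] := unit_direction (x - c).
have ub : ubound [set enorm (x - q) | q in eball c r] (enorm (x - c) + r).
  move=> _ [q cq <-]; apply: le_trans (enorm_dist_triangle c x q) _.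
  by rewrite lerD2l.
apply/le_anti/andP; split.
  apply: ge_sup => //; exists (enorm (x - c)); exists c => //.
  by rewrite /eball /closed_ball_ /= subrr enorm0.
apply: ub_le_sup; first by exists (enorm (x - c) + r).
exists (c - r *: u).
  by rewrite /eball /closed_ball_ /= opprB addrC subrK enormZ u1 mulr1 ger0_norm.
rewrite opprB addrCA addrC {1}xu -scalerDl enormZ u1 mulr1.
by rewrite ger0_norm// addr_ge0// enorm_ge0.
Qed.

Lemma mindist_ball x c s : 0 <= s ->
  mindist x (eball c s) = Num.max 0 (enorm (x - c) - s).
Proof.
move=> s0.
have lb : lbound [set enorm (x - q) | q in eball c s]
                 (Num.max 0 (enorm (x - c) - s)).
  move=> _ [q cq <-]; rewrite ge_max enorm_ge0 lerBlDr.
  apply: le_trans (enorm_dist_triangle q x c) _.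
  by rewrite lerD2l enormB_sym.
apply/le_anti/andP; split; last first.
  apply: lb_le_inf => //; exists (enorm (x - c)); exists c => //.
  by rewrite /eball /closed_ball_ /= subrr enorm0.
apply: ge_inf; first by exists (Num.max 0 (enorm (x - c) - s)).
have [u u1 xu] := unit_direction (x - c).
have [xs|xs] := leP (enorm (x - c)) s.
  exists x; first by rewrite /eball /closed_ball_ /= enormB_sym.
  rewrite subrr enorm0 max_l//; lra.
exists (c + s *: u).
  rewrite /eball /closed_ball_ /= opprD addrA subrr sub0r -scaleNr enormZ.
  by rewrite u1 mulr1 normrN ger0_norm.
rewrite opprD addrA {1}xu -scalerBl enormZ u1 mulr1 gtr0_norm ?subr_gt0//.
by rewrite max_r// subr_ge0 ltW.
Qed.

Lemma farthest_proj_ball x c r : 0 <= r -> c != x ->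
  farthest_proj x (eball c r) =
  [set x + (maxdist x (eball c r) / enorm (x - c)) *: (c - x)].
Proof.
move=> r0 cx; rewrite /farthest_proj maxdist_ball//; apply: tangent_ball => //.
  by rewrite addr_ge0 ?enorm_ge0.
by rewrite addrAC subrr add0r ger0_norm.
Qed.

Lemma shortest_proj_ball x c s : 0 <= s -> 0 < mindist x (eball c s) ->
  shortest_proj x (eball c s) =
  [set x + (mindist x (eball c s) / enorm (x - c)) *: (c - x)].
Proof.
move=> s0; rewrite /shortest_proj mindist_ball// lt_max ltxx /= => xs.
have xs' := ltW xs; rewrite max_r//; apply: tangent_ball => //.
  rewrite -subr_eq0; apply: contraTneq xs => cx.
  rewrite enormB_sym cx enorm0; lra.
by rewrite addrAC subrr sub0r normrN ger0_norm.
Qed.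

End BallDistances.

(** * The objective function *)

Section Objective.
Variables (R : realType) (n : nat) (I J : finType).
Variables (Omega : I -> set 'rV[R]_n) (Theta : J -> set 'rV[R]_n).

Lemma maxdist_le_objective x i : maxdist x (Omega i) <= objective Omega Theta x.
Proof. by rewrite le_max (le_bigmax _ (fun i => maxdist x (Omega i))). Qed.

Lemma mindist_le_objective x j : mindist x (Theta j) <= objective Omega Theta x.
Proof. by rewrite le_max (le_bigmax _ (fun j => mindist x (Theta j))) orbT. Qed.

Lemma objective_ge0 x : 0 <= objective Omega Theta x.
Proof. by rewrite le_max bigmax_ge_id. Qed.

Lemma objective_lt x k : 0 < k -> (forall i, maxdist x (Omega i) < k) ->
  (forall j, mindist x (Theta j) < k) -> objective Omega Theta x < k.
Proof. by move=> k0 hO hT; rewrite gt_max !bigmax_lt. Qed.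

End Objective.

(** * Optimality conditions for balls *)

Section BallProblem.
Variables (R : realType) (n : nat) (I J : finType).
Variables (a : I -> 'rV[R]_n.+1) (r : I -> R) (b : J -> 'rV[R]_n.+1) (s : J -> R).
Hypothesis r_gt0 : forall i, 0 < r i.
Hypothesis s_ge0 : forall j, 0 <= s j.
Implicit Types (x y v : 'rV[R]_n.+1).

Let Omega i := eball (a i) (r i).
Let Theta j := eball (b j) (s j).
Let G := objective Omega Theta.
Let K := active_far Omega Theta.
Let L := active_near Omega Theta.

Let maxdistE x i : maxdist x (Omega i) = enorm (x - a i) + r i.
Proof. by rewrite maxdist_ball// ltW. Qed.

Let farthest_projE x i : a i != x -> farthest_proj x (Omega i) =
  [set x + (maxdist x (Omega i) / enorm (x - a i)) *: (a i - x)].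
Proof. by apply: farthest_proj_ball; exact: ltW. Qed.

Let shortest_projE x j : 0 < mindist x (Theta j) -> shortest_proj x (Theta j) =
  [set x + (mindist x (Theta j) / enorm (x - b j)) *: (b j - x)].
Proof. exact: shortest_proj_ball. Qed.

Lemma objective_gt0 x : (0 < #|I|)%N -> 0 < G x.
Proof.
move=> /card_gt0P[i _]; apply: lt_le_trans (maxdist_le_objective _ _ x i).
by rewrite maxdistE ltr_wpDl ?enorm_ge0.
Qed.

Lemma mindist_lt y j k : 0 < k ->
  (mindist y (Theta j) < k) = (enorm (y - b j) - s j < k).
Proof. by move=> k0; rewrite mindist_ball// gt_max k0. Qed.

Lemma optimal_of_coinciding_ball x i : eball x (G x) = Omega i ->
  forall y, G x <= G y.
Proof.
move=> xi y; apply: le_trans (maxdist_le_objective _ _ y i).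
rewrite -xi maxdist_ball; last exact: objective_ge0.
by rewrite lerDr enorm_ge0.
Qed.

(** If [y] were better than [x], the half-space of the points [z] with
    [0 < <y - x, z - x>] would contain all the active projections, hence their
    hull and [x] itself. *)
Lemma optimal_of_hull x p q : 0 < G x ->
  (forall i, K x i -> farthest_proj x (Omega i) = [set p i]) ->
  (forall j, L x j -> shortest_proj x (Theta j) = [set q j]) ->
  convex_hull ((p @` K x) `|` (q @` L x)) x -> forall y, G x <= G y.
Proof.
move=> Gx hp hq hx y; rewrite leNgt; apply/negP => yx.
suff : [set z | 0 < dot (y - x) (z - x)] x by rewrite /= subrr dot0r ltxx.
apply: hx; split; first exact: open_halfspace_convex.
move=> z [[i Ki <-]|[j Lj <-]] /=.
  have [pi xp] : farthest_proj x (Omega i) (p i) by rewrite hp.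
  apply: dot_gt0_of_closer; rewrite xp (Ki : maxdist x _ = _).
  apply: le_lt_trans yx; apply: le_trans (maxdist_le_objective _ _ y i).
  rewrite maxdistE; apply: le_trans (enorm_dist_triangle (a i) _ _) _.
  by rewrite lerD2l.
(* [q j - x] is a positive multiple of [b j - x], and [y] is closer to [b j]. *)
have xj : mindist x (Theta j) = G x := Lj.
have : shortest_proj x (Theta j) (q j) by rewrite hq.
rewrite shortest_projE ?xj// => ->; rewrite addrAC subrr add0r dotZr.
have yb : enorm (y - b j) < enorm (x - b j).
  have hy : mindist y (Theta j) < G x by
    exact: le_lt_trans (mindist_le_objective _ _ y j) yx.
  have : ~~ (mindist x (Theta j) < G x) by rewrite xj ltxx.
  move: hy; rewrite !mindist_lt// -leNgt; lra.
rewrite mulr_gt0 ?divr_gt0// ?dot_gt0_of_closer//.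
exact: le_lt_trans (enorm_ge0 _) yb.
Qed.

(** When an active [Omega i0] is centered at [x], its radius is [G x]. The other
    two requirements only say that [G x] bounds all the distances. *)
Lemma coinciding_ball_of_active_center x i0 : K x i0 -> a i0 = x ->
  exists S : {set I},
    [/\ (1 <= #|S|)%N,
        (forall i, i \in S <-> eball x (G x) = Omega i),
        (forall i, i \notin S -> Omega i `<=` eball x (G x)) &
        (forall j, eball x (G x) `&` Theta j !=set0)].
Proof.
move=> Ki ai.
have xi : eball x (G x) = Omega i0.
  by rewrite -(Ki : maxdist x _ = G x) maxdistE ai subrr enorm0 add0r /Omega ai.
exists [set i | `[< eball x (G x) = Omega i >]]%SET; split.
- by apply/card_gt0P; exists i0; rewrite inE; apply/asboolP.
- by move=> i; rewrite inE; split=> /asboolP.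
- move=> i _ z iz; apply: le_trans (maxdist_le_objective _ _ x i).
  rewrite maxdistE; apply: le_trans (enorm_dist_triangle (a i) _ _) _.
  by rewrite lerD2l.
- move=> j; have [xj|xj] := ltP 0 (mindist x (Theta j)).
    have [] : shortest_proj x (Theta j)
      (x + (mindist x (Theta j) / enorm (x - b j)) *: (b j - x)).
      by rewrite shortest_projE.
    move=> jz xz; eexists; split; last exact: jz.
    by rewrite /eball /closed_ball_ /= xz mindist_le_objective.
  exists x; split.
    by rewrite /eball /closed_ball_ /= subrr enorm0 objective_ge0.
  move: xj; rewrite mindist_ball// ge_max lexx subr_le0.
  by rewrite /Theta /eball /closed_ball_ /= enormB_sym.
Qed.

(** A vector [v] separating [x] from the hull would be a descent direction: for
    small [t > 0] the point [x + t v] is strictly closer to the centers of all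
    the active balls, and the distances to the other balls stay below [G x] by
    continuity. *)
Lemma hull_of_optimal x : 0 < G x -> (forall y, G x <= G y) ->
  (forall i, K x i -> a i != x) ->
  exists (p : I -> 'rV[R]_n.+1) (q : J -> 'rV[R]_n.+1),
    [/\ (forall i, K x i -> farthest_proj x (Omega i) = [set p i]),
        (forall j, L x j -> shortest_proj x (Theta j) = [set q j]) &
        convex_hull ((p @` K x) `|` (q @` L x)) x].
Proof.
move=> Gx hx ax.
pose p i := x + (G x / enorm (x - a i)) *: (a i - x).
pose q j := x + (G x / enorm (x - b j)) *: (b j - x).
have hp i : K x i -> farthest_proj x (Omega i) = [set p i].
  move=> Ki; rewrite farthest_projE ?ax//.
  by rewrite (Ki : maxdist x _ = G x).
have hq j : L x j -> shortest_proj x (Theta j) = [set q j].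
  move=> Lj; have xj : mindist x (Theta j) = G x := Lj.
  by rewrite shortest_projE xj.
exists p, q; split=> //; apply: contrapT => hN.
have [v hv] : exists v, forall z, ((p @` K x) `|` (q @` L x)) z ->
    0 < dot v (z - x).
  apply: convex_hull_separation => //.
  by rewrite finite_setU; split; exact: finite_image.
have dir c : 0 < dot v (x + (G x / enorm (x - c)) *: (c - x) - x) ->
    0 < dot v (c - x).
  rewrite addrAC subrr add0r dotZr; have [->|cx] := eqVneq (enorm (x - c)) 0.
    by rewrite invr0 mulr0 mul0r ltxx.
  by rewrite pmulr_rgt0// divr_gt0// lt_neqAle eq_sym cx enorm_ge0.
have far : \forall t \near 0^'+, forall i, enorm (x + t *: v - a i) < G x - r i.
  apply: filter_forall => i; have [Ki|Ki] := eqVneq (maxdist x (Omega i)) (G x).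
    rewrite -Ki maxdistE addrK; apply: near_ray_descent; apply: dir.
    by apply: hv; left; exists i.
  apply: near_ray_lt; rewrite ltrBrDr -maxdistE lt_neqAle Ki.
  exact: maxdist_le_objective.
have near : \forall t \near 0^'+, forall j, enorm (x + t *: v - b j) < G x + s j.
  apply: filter_forall => j; have [Lj|Lj] := eqVneq (mindist x (Theta j)) (G x).
    have xj : enorm (x - b j) - s j = G x.
      move: Lj Gx; rewrite mindist_ball//.
      by have [_ <-|//] := leP (enorm (x - b j) - s j) 0; rewrite ltxx.
    rewrite -xj subrK; apply: near_ray_descent; apply: dir.
    by apply: hv; right; exists j.
  apply: near_ray_lt; rewrite -ltrBlDr -mindist_lt// lt_neqAle Lj.
  exact: mindist_le_objective.
near (0 : R)^'+ => t; have := hx (x + t *: v); rewrite leNgt => /negP; apply.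
apply: objective_lt => // [i|j].
  by rewrite maxdistE -ltrBrDr; move: i; near: t.
by rewrite mindist_lt// ltrBlDr; move: j; near: t.
Unshelve. all: by end_near. Qed.

End BallProblem.

Theorem theorem3p2 (R : realType) (n : nat) (I J : finType)
    (a : I -> 'rV[R]_n) (r : I -> R) (b : J -> 'rV[R]_n) (s : J -> R)
    (hIJ : (1 < #|I| + #|J|)%N) (hI : (0 < #|I|)%N)
    (hr : forall i, 0 < r i) (hs : forall j, 0 <= s j)
    (xbar : 'rV[R]_n) :
  let Omega := fun i => eball (a i) (r i) in
  let Theta := fun j => eball (b j) (s j) in
  let G := objective Omega Theta in
  let K := active_far Omega Theta in
  let L := active_near Omega Theta in
  (forall x : 'rV[R]_n, G xbar <= G x) <->
  ((exists S : {set I},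
      [/\ (1 <= #|S|)%N,
          (forall i, i \in S <-> eball xbar (G xbar) = Omega i),
          (forall i, i \notin S -> Omega i `<=` eball xbar (G xbar)) &
          (forall j, eball xbar (G xbar) `&` Theta j !=set0)])
   \/
   (exists (p : I -> 'rV[R]_n) (q : J -> 'rV[R]_n),
      [/\ (forall i, K xbar i -> farthest_proj xbar (Omega i) = [set p i]),
          (forall j, L xbar j -> shortest_proj xbar (Theta j) = [set q j]) &
          convex_hull ((p @` K xbar) `|` (q @` L xbar)) xbar])).
Proof.
move=> Omega Theta G K L; case: n => [|n] in a b xbar Omega Theta G K L *.
  have eballT (c : 'rV[R]_0) k : 0 <= k -> eball c k = setT.
    move=> k0; apply/seteqP; split=> // z _.
    by rewrite /eball /closed_ball_ /= (thinmx0 (c - z)) enorm0.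
  split=> [_|_ x]; last by rewrite (thinmx0 x) (thinmx0 xbar).
  have OmegaT i : Omega i = setT by apply: eballT; exact: ltW.
  have xbarT : eball xbar (G xbar) = setT by apply: eballT; exact: objective_ge0.
  left; exists [set: I]%SET; rewrite xbarT; split.
  - by rewrite cardsT.
  - by move=> i; rewrite finset.in_setT OmegaT.
  - by move=> i; rewrite finset.in_setT.
  - by move=> j; exists 0; split=> //; rewrite /Theta eballT.
have Gx : 0 < G xbar by exact: objective_gt0.
split=> [opt|[[S [S0 SE _ _]]|[p [q [hp hq hx]]]]].
- have [[i [Ki ai]]|noc] := pselect (exists i, K xbar i /\ a i = xbar).
    by left; exact: coinciding_ball_of_active_center Ki ai.
  right; apply: hull_of_optimal => // i Ki; apply/eqP => ai.
  by apply: noc; exists i.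
- have /card_gt0P[i /SE iS] := S0.
  exact: optimal_of_coinciding_ball iS.
- exact: optimal_of_hull hx.
Qed.
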